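(* Each of the following statements implies the next: (a) There exist $0<\alpha<1/2$ and $0<\beta<2$ such that $\operatorname{PaleyDiscrepancy}[\alpha,\beta]$ holds, i.e., for every sufficiently large prime $p\equiv 1 \bmod 4$, \[ \bigg|\sum_{a,b\in S}\chi(a-b)\bigg|<|S|^{2-\beta}\qquad\text{for all } S\subseteq\mathbb{F}_p \text{ with } |S|>p^\alpha . \] (b) There exist $\gamma>1/2$ and $\tau<1/2$ such that for every $\epsilon>0$, $\operatorname{PaleyRIP}[\gamma,\tau-1/2+\epsilon]$ holds, i.e., for every sufficiently large prime $p\equiv 1\bmod 4$, the $\frac{p+1}{2}\times(p+1)$ Paley matrix $\Phi_p$ satisfies the $(p^\gamma,p^{\tau-1/2+\epsilon})$-restricted isometry property. (c) There exists $\tau<1/2$ such that for every $\epsilon>0$, $\operatorname{PaleyClique}[\tau+\epsilon]$ holds, i.e., for every sufficiently large prime $p\equiv 1\bmod 4$, the largest clique in the Paley graph on $p$ vertices has at most $p^{\tau+\epsilon}$ vertices.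
   Context: Throughout, $p\equiv 1 \bmod 4$ is prime, $\mathbb{F}_p$ is the field with $p$ elements, and $\chi:\mathbb{F}_p\to\{-1,0,1\}$ is the Legendre symbol: $\chi(0)=0$, $\chi(x)=1$ if $x$ is a nonzero square, $\chi(x)=-1$ otherwise. The Paley graph on $p$ vertices has vertex set $\mathbb{F}_p$, with $x\sim y$ iff $\chi(x-y)=1$. Write $e(a)=e^{2\pi i a/p}$. Paley matrix: let $Q=\{x\in\mathbb{F}_p:\chi(x)\ge 0\}$ (the squares including $0$), so $M:=|Q|=(p+1)/2$. Let $H$ be the $M\times p$ matrix with rows indexed by $x\in Q$ (with $x=0$ as the first row) and columns indexed by $j\in\{0,1,\dots,p-1\}$, with entries $H[x,j]=e(-xj)$ (equivalently $H[i,j]=e(-i^2 j)$ for $i=0,1,\dots,(p-1)/2$). Let $\tilde\Phi$ be obtained from $H$ by scaling the first row by $\sqrt{1/p}$ and every other row by $\sqrt{2/p}$. The Paley matrix $\Phi_p$ is the $M\times (p+1)$ matrix obtained by appending to $\tilde\Phi$ the column $(1,0,\dots,0)^\top$ (the first standard basis vector of $\mathbb{C}^M$). An $M\times N$ matrix $\Phi$ satisfies the $(K,\delta)$-restricted isometry property (with $0\le\delta<1$) if $(1-\delta)\|x\|^2\le\|\Phi x\|^2\le(1+\delta)\|x\|^2$ for every $x\in\mathbb{R}^N$ having at most $K$ nonzero entries, where $\|\cdot\|$ is the Euclidean norm.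
   Formalization: The requirement δ<1 in the restricted isometry property is dropped (only the two norm inequalities are kept), since in (b) δ=p^{τ-1/2+ε} is at least 1 once ε≥1/2-τ, which would make (b) fail outright; for smaller ε nothing changes. *)

(* Defs.v *)
From HB Require Import structures.
From mathcomp Require Import all_boot all_order all_algebra.
From mathcomp Require Import all_classical all_reals all_analysis.
Set Implicit Arguments. Unset Strict Implicit. Unset Printing Implicit Defensive.
Import Order.TTheory GRing.Theory Num.Theory.
Local Open Scope ring_scope.

Definition legendre (p : nat) (x : 'F_p) : int :=
  if x == 0 then 0 else if [exists y : 'F_p, y ^+ 2 == x] then 1 else -1.

Definition paley_clique (p : nat) (S : {set 'F_p}) : Prop :=
  forall x y, x \in S -> y \in S -> x != y -> legendre (x - y) = 1.

(* Paley matrix Phi_p, of size ((p+1)/2) x (p+1), split into real and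
   imaginary parts.  Row i (0 <= i <= (p-1)/2) corresponds to x = i^2;
   column j < p has entry c_i * e(-i^2 j) with c_0 = sqrt(1/p),
   c_i = sqrt(2/p) otherwise, e(a) = exp(2 pi i a / p);
   column p is the first standard basis vector. *)
Definition paley_scale {R : realType} (p : nat) (i : nat) : R :=
  if i == 0%N then Num.sqrt (1 / p%:R) else Num.sqrt (2 / p%:R).

Definition paley_angle {R : realType} (p i j : nat) : R :=
  - (2 * pi * (i ^ 2 * j)%N%:R / p%:R).

Definition paley_re {R : realType} (p : nat) (i j : nat) : R :=
  if (j < p)%N then paley_scale p i * cos (paley_angle p i j)
  else (i == 0%N)%:R.

Definition paley_im {R : realType} (p : nat) (i j : nat) : R :=
  if (j < p)%N then paley_scale p i * sin (paley_angle p i j)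
  else 0.

Definition paley_normsq {R : realType} (p : nat) (x : 'I_p.+1 -> R) : R :=
  \sum_(i < (p.+1)./2)
    ((\sum_(j < p.+1) paley_re p i j * x j) ^+ 2
     + (\sum_(j < p.+1) paley_im p i j * x j) ^+ 2).

Definition paley_RIP {R : realType} (p : nat) (K delta : R) : Prop :=
  forall x : 'I_p.+1 -> R,
    (#|[set j | x j != 0]|%:R <= K) ->
    (1 - delta) * (\sum_j x j ^+ 2) <= @paley_normsq R p x /\
    @paley_normsq R p x <= (1 + delta) * (\sum_j x j ^+ 2).

Definition eventually_paley (P : nat -> Prop) : Prop :=
  exists P0 : nat, forall p : nat, prime p -> (p %% 4 = 1)%N -> (P0 <= p)%N -> P p.

Definition PaleyDiscrepancy {R : realType} (alpha beta : R) : Prop :=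
  eventually_paley (fun p => forall S : {set 'F_p},
    (p%:R : R) `^ alpha < #|S|%:R ->
    (`| \sum_(a in S) \sum_(b in S) legendre (a - b) |%:~R : R)
      < (#|S|%:R : R) `^ (2 - beta)).

Definition PaleyRIP {R : realType} (gamma delta_exp : R) : Prop :=
  eventually_paley (fun p =>
    paley_RIP p ((p%:R : R) `^ gamma) ((p%:R : R) `^ delta_exp)).

Definition PaleyClique {R : realType} (e : R) : Prop :=
  eventually_paley (fun p => forall S : {set 'F_p},
    paley_clique S -> (#|S|%:R : R) <= (p%:R : R) `^ e).

Definition stmtA (R : realType) : Prop :=
  exists alpha beta : R, 0 < alpha < 1/2 /\ 0 < beta < 2 /\
    PaleyDiscrepancy alpha beta.

Definition stmtB (R : realType) : Prop :=
  exists gamma tau : R, 1/2 < gamma /\ tau < 1/2 /\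
    forall eps : R, 0 < eps -> PaleyRIP gamma (tau - 1/2 + eps).

Definition stmtC (R : realType) : Prop :=
  exists tau : R, tau < 1/2 /\
    forall eps : R, 0 < eps -> PaleyClique (tau + eps).

(* Main.v *)
Require Import Defs.
From mathcomp Require Import all_boot all_order all_algebra.
From mathcomp Require Import all_fingroup all_solvable all_field.
From mathcomp Require Import all_classical all_reals all_analysis.
From mathcomp Require Import ring lra zify.
Set Implicit Arguments. Unset Strict Implicit. Unset Printing Implicit Defensive.
Import Order.TTheory GRing.Theory Num.Theory.
Local Open Scope ring_scope.

(* For p = 1 mod 4 the quadratic Gauss sum g is real with g^2 = p, so on real vectors
   |Phi x|^2 - |x|^2 is p^(-1/2) times the quadratic form of a bordered matrix
   (chi(a - b)); the sign of g only affects the sign of the block (chi(a - b)) and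
   plays no role.

   (a) => (b): by polarization, a discrepancy bound on the subsets of a K-set S gives
   |E(A, B)| <= M for the character sums E(A, B) with A, B inside S; combined with the
   trivial bound |A||B| it yields the homogeneous estimate E(A, B)^2 <= M |A||B|.
   A vector l whose sums satisfy (sum_A l)^2 <= c |A| for all A in S has squared norm
   at most 2 c H_|S| (H_n the harmonic number); applying this once per variable turns
   the flat estimate into a bound on the quadratic form with only a logarithmic loss,
   and the slack in the exponent tau absorbs the logarithm.

   (b) => (c): test the isometry property on the indicator of a subclique of size just
   above p^(tau + eps), which is below p^gamma. *)

(** * Squares and the quadratic character of a finite field *)

Lemma units_generator (F : finFieldType) :
  exists g : {unit F}, forall a : F, a != 0 -> exists n, a = val g ^+ n.
Proof.
have /cyclicP[g Hg] := field_unit_group_cyclic [set: {unit F}]%G.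
exists g => a a0.
have ua : a \is a GRing.unit by rewrite unitfE.
have : FinRing.unit F ua \in [set: {unit F}]%G by rewrite inE.
rewrite /= Hg => /cycleP[n Hn]; exists n.
by rewrite -FinRing.val_unitX -Hn.
Qed.

(** A nonsquare is an odd power of a generator of the unit group, and two odd exponents add up to an
    even one. *)
Lemma mulr_nonsquare (F : finFieldType) (a b : F) :
  ~~ [exists y : F, y ^+ 2 == a] -> ~~ [exists y : F, y ^+ 2 == b] ->
  [exists y : F, y ^+ 2 == a * b].
Proof.
have [g Hg] := units_generator F.
have nsq (c : F) : ~~ [exists y : F, y ^+ 2 == c] -> exists n, c = val g ^+ n.*2.+1.
  move=> cN; have c0 : c != 0.
    by apply: contraNneq cN => ->; apply/existsP; exists 0; rewrite expr0n.
  have [n cE] := Hg c c0; exists n./2; move: cN.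
  rewrite {}cE -{1 2}(odd_double_half n); case: (odd n) => //.
  rewrite add0n => /existsPn/(_ (val g ^+ n./2)).
  by rewrite -exprM muln2 eqxx.
move=> /nsq[m ->] /nsq[n ->]; apply/existsP; exists (val g ^+ (m + n).+1).
by rewrite -exprM -exprD; apply/eqP; congr (_ ^+ _); lia.
Qed.

(** With [#|F| = 4k + 1], the [4k] nonzero elements cannot all be among the at most [2k] roots of
    [x^(2k) = 1]. Any other nonzero [x] has [x^(2k) = -1], since [x^(4k) = 1], and [x^k] is the
    required root. *)
Lemma oppr1_square (F : finFieldType) : (#|F| %% 4 = 1)%N -> exists y : F, y ^+ 2 = -1.
Proof.
move=> F4; have [k kE] : exists k, #|F| = (4 * k).+1.
  by exists (#|F| %/ 4)%N; rewrite [LHS](divn_eq _ 4) F4 mulnC addn1.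
have k0 : (0 < 2 * k)%N by have := card_finNzRing_gt1 F; rewrite kE; lia.
have : ~~ all (2 * k).-unity_root (rem 0 (enum F)).
  apply/negP => /(max_unity_roots k0)/(_ (rem_uniq _ (enum_uniq _))).
  by rewrite size_rem ?mem_enum // -cardE kE; lia.
move=> /allPn[x]; rewrite mem_rem_uniq ?enum_uniq // !inE => /andP[x0 _] xN1.
exists (x ^+ k); have := expf_card x.
rewrite kE exprS => /(canRL (mulKf x0)).
rewrite mulVf // -[(4 * k)%N]/((2 * 2) * k)%N -mulnA mulnC exprM => /eqP.
rewrite sqrf_eq1 -unity_rootE (negPf xN1) /= => /eqP <-.
by rewrite -exprM mulnC.
Qed.

(* [legendre] is [quad_char] on ['F_p], up to conversion. *)
Definition quad_char (F : finFieldType) (a : F) : int :=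
  if a == 0 then 0 else if [exists y : F, y ^+ 2 == a] then 1 else -1.

Lemma quad_charM (F : finFieldType) : {morph @quad_char F : a b / a * b}.
Proof.
move=> a b; rewrite /quad_char mulf_eq0.
have [->|a0] := eqVneq a 0; first by rewrite /= mul0r.
have [->|b0] := eqVneq b 0; first by rewrite orbT mulr0.
have [aS|aN] /= := boolP [exists y : F, y ^+ 2 == a]; last first.
  have [bS|bN] := boolP [exists y : F, y ^+ 2 == b]; last first.
    by rewrite mulr_nonsquare // mulrNN mulr1.
  rewrite mulr1 ifN //; apply: contra aN => /existsP[w /eqP wE].
  have /existsP[z /eqP zE] := bS.
  by apply/existsP; exists (w / z); rewrite expr_div_n wE zE mulfK.
have /existsP[y /eqP yE] := aS.
have y0 : y != 0 by apply: contraNneq a0 => y0; rewrite -yE y0 expr0n.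
rewrite mul1r; congr (if _ then _ else _).
apply/existsP/existsP => -[w /eqP wE].
  by exists (w / y); rewrite expr_div_n wE yE mulrC mulKf.
by exists (y * w); rewrite exprMn yE wE.
Qed.

Lemma quad_char_sqr (F : finFieldType) (a : F) : quad_char a ^+ 2 = (a != 0)%:R.
Proof. by rewrite /quad_char; case: ifP => // _; case: ifP. Qed.

Lemma quad_charN (F : finFieldType) (i : F) (iE : i ^+ 2 = -1) (a : F) :
  quad_char (- a) = quad_char a.
Proof.
rewrite -mulN1r quad_charM {1}/quad_char oppr_eq0 oner_eq0.
by case: existsP => [_|[]]; [rewrite mul1r | exists i; rewrite iE].
Qed.

(** A nonzero square has exactly the roots [w] and [- w], distinct because [2] is nonzero. This
    count converts sums over squares into character sums. *)
Lemma sum_sqr_eq (F : finFieldType) (two_neq0 : 2%:R != 0 :> F)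
    (R : realFieldType) (z : F) :
  \sum_(y | y ^+ 2 == z) 1 = 1 + (quad_char z)%:~R :> R.
Proof.
rewrite /quad_char; have [->|z0] := eqVneq z 0.
  rewrite (eq_bigl (pred1 0)) => [|y]; first by rewrite big_pred1_eq addr0.
  by rewrite /= expf_eq0.
case: ifPn => [/existsP[w /eqP wE]|zN]; last first.
  rewrite big_pred0 ?subrr // => y; apply/negbTE.
  by apply: contra zN => yz; apply/existsP; exists y.
have wNw : w != - w.
  rewrite -subr_eq0 opprK -mulr2n -mulr_natl mulf_neq0 //.
  by apply: contraNneq z0 => w0; rewrite -wE w0 expr0n.
rewrite (bigD1 w) ?wE //= (bigD1 (- w)) /= ?sqrrN ?wE ?eqxx ?[_ == w]eq_sym //.
rewrite big1 ?addr0 // => y; rewrite -wE eqf_sqr.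
by case: eqVneq => //= _; rewrite andbT andbN.
Qed.

Lemma sum_sqr_quad_char (F : finFieldType) (two_neq0 : 2%:R != 0 :> F)
    (R : realFieldType) (f : F -> R) :
  \sum_(y : F) f (y ^+ 2) = \sum_(z : F) (1 + (quad_char z)%:~R) * f z.
Proof.
rewrite (partition_big (fun y => y ^+ 2) xpredT) //=; apply: eq_bigr => z _.
rewrite -sum_sqr_eq // mulr_suml; apply: eq_bigr => y /eqP->.
by rewrite mul1r.
Qed.

(** Summing the constant [1] over all [y ^+ 2] already gives the size of [F], so the character part
    must vanish. *)
Lemma sum_quad_char (F : finFieldType) (two_neq0 : 2%:R != 0 :> F)
    (R : realFieldType) :
  \sum_(z : F) (quad_char z)%:~R = 0 :> R.
Proof.
have := sum_sqr_quad_char two_neq0 (fun=> 1 : R).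
under [RHS]eq_bigr do rewrite mulr1.
by rewrite big_split /= -[LHS]addr0 => /addrI.
Qed.

(** * Quadratic Gauss sums over a finite field *)

Lemma sum_scaled (F : finFieldType) (R : realFieldType) (c : F -> R) (a : F) :
  \sum_(z : F) c z = 0 -> a != 0 -> \sum_(z : F) c (a * z) = 0.
Proof. by move=> c0 a0; rewrite -[RHS]c0 [RHS](reindex_inj (mulfI a0)). Qed.

Lemma quad_gauss_twist (F : finFieldType) (R : realFieldType) (c : F -> R) (a : F) :
  a != 0 -> \sum_(z : F) (quad_char z)%:~R * c (a * z)
    = (quad_char a)%:~R * \sum_(z : F) (quad_char z)%:~R * c z.
Proof.
move=> a0; rewrite [in RHS](reindex_inj (mulfI a0)) mulr_sumr.
apply: eq_bigr => z _; rewrite quad_charM intrM !mulrA -expr2 -rmorphXn /=.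
by rewrite quad_char_sqr a0 mul1r.
Qed.

(* [c] plays the real part of a nontrivial additive character. *)
Lemma quad_gauss_sqr (F : finFieldType) (two_neq0 : 2%:R != 0 :> F)
    (i : F) (iE : i ^+ 2 = -1) (R : realFieldType) (c : F -> R)
    (c0 : c 0 = 1) (sumc : \sum_(z : F) c z = 0)
    (cM : forall u v, c (u + v) + c (u - v) = 2 * (c u * c v)) :
  (\sum_(z : F) (quad_char z)%:~R * c z) ^+ 2 = #|F|%:R :> R.
Proof.
set g := \sum_(z : F) _; set q := #|F|%:R.
have delta (w : F) : \sum_(a : F) c (a * w) = q * (w == 0)%:R :> R.
  have [->|w0] := eqVneq w 0.
    by under eq_bigr do rewrite mulr0 c0; rewrite sumr_const mulr1.
  by under eq_bigr do rewrite mulrC; rewrite sum_scaled // mulr0.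
(* The second moment of the twisted sums [T a] is computed twice: twisting gives [(q - 1) * g ^+ 2],
   orthogonality gives [q * (q - 1)]. *)
pose T a := \sum_(z : F) (quad_char z)%:~R * c (a * z).
have TE a : T a = (quad_char a)%:~R * g.
  rewrite /T; have [->|a0] := eqVneq a 0; last exact: quad_gauss_twist.
  under eq_bigr do rewrite mul0r c0 mulr1.
  by rewrite sum_quad_char // /quad_char eqxx mul0r.
have cardN0 : \sum_(z : F) (quad_char z)%:~R ^+ 2 = q - 1 :> R.
  under eq_bigr do rewrite -rmorphXn /= quad_char_sqr.
  rewrite (bigD1 0) //= eqxx add0r /q.
  have -> : #|F|%:R = \sum_(z : F) 1 :> R by rewrite sumr_const.
  rewrite [in RHS](bigD1 0) //= addrAC subrr add0r.
  by apply: eq_bigr => z ->.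
have lhs : \sum_(a : F) T a ^+ 2 = (q - 1) * g ^+ 2.
  by under eq_bigr do rewrite TE exprMn; rewrite -mulr_suml cardN0.
(* The factor 2 matches the product-to-sum rule [cM], which splits each product into the frequencies
   [z + w] and [z - w]. *)
have rhs : 2 * \sum_(a : F) T a ^+ 2 = 2 * (q * (q - 1)).
  have -> : 2 * \sum_(a : F) T a ^+ 2 = \sum_(z : F) \sum_(w : F) (quad_char z)%:~R * (quad_char w)%:~R *
      (q * (z + w == 0)%:R + q * (z - w == 0)%:R).
    under [RHS]eq_bigr => z _ do under eq_bigr => w _ do
      rewrite -!delta -big_split mulr_sumr.
    under [RHS]eq_bigr => z _ do rewrite exchange_big /=.
    rewrite [RHS]exchange_big mulr_sumr; apply: eq_bigr => a _ /=.
    rewrite expr2 /T mulr_suml mulr_sumr; apply: eq_bigr => z _.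
    rewrite !mulr_sumr; apply: eq_bigr => w _.
    have := cM (a * z) (a * w); rewrite -mulrDr -mulrBr => ->; ring.
  rewrite -cardN0 mulr_natl mulr2n -mulrDr -big_split mulr_sumr /=.
  apply: eq_bigr => z _.
  under eq_bigr do rewrite mulrDr.
  (* Only [w = - z] and [w = z] survive, and they contribute equally because the character is
     even. *)
  rewrite big_split /= (bigD1 (- z)) //= [X in _ + X = _](bigD1 z) //=.
  rewrite subrr eqxx !mulr1 (quad_charN iE).
  rewrite big1 ?big1 => [|w|w]; last 2 first.
  - by rewrite subr_eq0 eq_sym => /negPf->; rewrite !mulr0.
  - by rewrite addrC addr_eq0 => /negPf->; rewrite !mulr0.
  ring.
have q1 : q - 1 != 0 by rewrite subr_eq0 (eqr_nat R _ 1) gtn_eqF ?card_finNzRing_gt1.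
have two0 : 2 != 0 :> R by rewrite pnatr_eq0.
by move: rhs; rewrite lhs => /(mulfI two0); rewrite mulrC => /(mulIf q1).
Qed.

(** * The additive character of the prime field, in real form *)

(** With [Fp_sin], the real and imaginary parts of [e(a)], taken at the canonical representative of
    [a]. *)
Definition Fp_cos (R : realType) (p : nat) (a : 'F_p) : R :=
  cos (2 * pi * (a : nat)%:R / p%:R).
Definition Fp_sin (R : realType) (p : nat) (a : 'F_p) : R :=
  sin (2 * pi * (a : nat)%:R / p%:R).
Arguments Fp_cos {R p}.
Arguments Fp_sin {R p}.

Lemma Fp_cos_sin_nat (R : realType) (p : nat) (p_pr : prime p) (n : nat) :
  cos (2 * pi * n%:R / p%:R) = Fp_cos (n%:R : 'F_p) :> R /\
  sin (2 * pi * n%:R / p%:R) = Fp_sin (n%:R : 'F_p) :> R.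
Proof.
rewrite /Fp_cos /Fp_sin val_Fp_nat // [in LHS](divn_eq n p) [in X in _ /\ X = _](divn_eq n p).
have p0 : p%:R != 0 :> R by rewrite pnatr_eq0; case: p p_pr.
rewrite (_ : _ / _ = 2 * pi * (n %% p)%N%:R / p%:R + (pi *+ 2) *+ (n %/ p)); last first.
  by rewrite natrD natrM -[(pi *+ 2) *+ _]mulr_natl -[pi *+ 2]mulr_natl; field.
by split; rewrite periodicn //; [exact: cosD2pi | exact: sinD2pi].
Qed.

Lemma Fp_cosD (R : realType) (p : nat) (p_pr : prime p) (a b : 'F_p) :
  Fp_cos (a + b) = Fp_cos a * Fp_cos b - Fp_sin a * Fp_sin b :> R /\
  Fp_sin (a + b) = Fp_sin a * Fp_cos b + Fp_cos a * Fp_sin b :> R.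
Proof.
have -> : a + b = (a + b)%N%:R by rewrite natrD !natr_Zp.
have [<- <-] := Fp_cos_sin_nat R p_pr (a + b).
by rewrite natrD mulrDr mulrDl; split; [exact: cosD | exact: sinD].
Qed.

Lemma Fp_cos0 (R : realType) (p : nat) : Fp_cos (0 : 'F_p) = 1 :> R.
Proof. by rewrite /Fp_cos mulr0 mul0r cos0. Qed.

Lemma Fp_sin0 (R : realType) (p : nat) : Fp_sin (0 : 'F_p) = 0 :> R.
Proof. by rewrite /Fp_sin mulr0 mul0r sin0. Qed.

(** The addition formulas for [a + (- a) = 0] form a linear system in the two values at [- a], with
    determinant [cos^2 + sin^2 = 1]. Solving it avoids computing the representative of [- a]. *)
Lemma Fp_cosN (R : realType) (p : nat) (p_pr : prime p) (a : 'F_p) :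
  Fp_cos (- a) = Fp_cos a :> R /\ Fp_sin (- a) = - Fp_sin a :> R.
Proof.
have [] := Fp_cosD R p_pr a (- a); rewrite subrr Fp_cos0 Fp_sin0.
have : Fp_cos a ^+ 2 + Fp_sin a ^+ 2 = 1 :> R by exact: cos2Dsin2.
set c := Fp_cos a; set s := Fp_sin a; set c' := Fp_cos _; set s' := Fp_sin _.
move=> H1 H2 H3; split.
  have -> : c' = c * (c * c' - s * s') + s * (s * c' + c * s') + c' * (1 - (c ^+ 2 + s ^+ 2)).
    by ring.
  by rewrite -H2 -H3 H1; ring.
have -> : s' = c * (s * c' + c * s') - s * (c * c' - s * s') + s' * (1 - (c ^+ 2 + s ^+ 2)).
  by ring.
by rewrite -H2 -H3 H1; ring.
Qed.

Lemma Fp_cosB (R : realType) (p : nat) (p_pr : prime p) (a b : 'F_p) :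
  Fp_cos (a - b) = Fp_cos a * Fp_cos b + Fp_sin a * Fp_sin b :> R.
Proof.
have [-> _] := Fp_cosD R p_pr a (- b).
by have [-> ->] := Fp_cosN R p_pr b; rewrite mulrN opprK.
Qed.

(** The sine sum vanishes by oddness, so shifting the index by 1 multiplies the cosine sum by
    [cos (2 pi / p)], which is less than 1. *)
Lemma sum_Fp_cos (R : realType) (p : nat) (p_pr : prime p) (p2 : (2 < p)%N) :
  \sum_(a : 'F_p) Fp_cos a = 0 :> R.
Proof.
have p0 : 0 < p%:R :> R by rewrite ltr0n prime_gt0.
have shift (f : 'F_p -> R) : \sum_(a : 'F_p) f (a + 1) = \sum_(a : 'F_p) f a.
  by rewrite [RHS](reindex_inj (addIr 1)).
have sin_sum : \sum_(a : 'F_p) Fp_sin a = 0 :> R.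
  have : \sum_(a : 'F_p) Fp_sin a = - \sum_(a : 'F_p) Fp_sin a :> R.
    rewrite {1}(reindex_inj oppr_inj) -sumrN; apply: eq_bigr => a _ /=.
    by have [_ ->] := Fp_cosN R p_pr a.
  lra.
have c1 : Fp_cos (1 : 'F_p) < 1 :> R.
  have [<- _] := Fp_cos_sin_nat R p_pr 1.
  have pi0 := pi_gt0 R.
  rewrite lt_neqAle cos_le1 andbT; apply/eqP => E.
  (* The angle lies in [[0, pi]], where [cos] is injective. *)
  have : 2 * pi * 1%:R / p%:R = 0 :> R.
    apply: cos_inj; last by rewrite E cos0.
      rewrite in_itv /= mulr1 ler_pdivrMr //.
      rewrite divr_ge0 ?ler0n ?mulr_ge0 ?pi_ge0 //= mulrC ler_pM2l //.
      by rewrite (ler_nat R 2) ltnW.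
    by rewrite in_itv /= lexx pi_ge0.
  by apply/eqP; rewrite gt_eqF // divr_gt0 // !mulr_gt0.
have := shift Fp_cos; under eq_bigr do rewrite (proj1 (Fp_cosD R p_pr _ _)).
rewrite sumrB -!mulr_suml sin_sum mul0r subr0 => H.
have /eqP : \sum_(a : 'F_p) Fp_cos a * (Fp_cos (1 : 'F_p) - 1) = 0 :> R.
  by rewrite -mulr_suml mulrBr H mulr1 subrr.
by rewrite -mulr_suml mulf_eq0 (subr_eq0 (Fp_cos _)) (lt_eqF c1) orbF => /eqP.
Qed.

Lemma Fp_two_neq0 (p : nat) (p_pr : prime p) (p2 : (2 < p)%N) : 2%:R != 0 :> 'F_p.
Proof. by apply/eqP => E; have := val_Fp_nat p_pr 2; rewrite E modn_small. Qed.

Lemma Fp_sqrtN1 (p : nat) (p_pr : prime p) (p4 : (p %% 4 = 1)%N) :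
  exists i : 'F_p, i ^+ 2 = -1.
Proof. by apply: oppr1_square; rewrite card_Fp. Qed.

Lemma prime_mod4_gt2 (p : nat) : prime p -> (p %% 4 = 1)%N -> (2 < p)%N.
Proof. by case: p => [|[|[|]]]. Qed.

(** * The quadratic Gauss sum of the prime field *)

(** For [p] congruent to 1 mod 4 this is the full Gauss sum: [legendre] is even, so the sine part
    cancels. *)
Definition paley_gauss (R : realType) (p : nat) : R :=
  \sum_(y : 'F_p) (legendre y)%:~R * Fp_cos y.

Lemma paley_gauss_sqr (R : realType) (p : nat) (p_pr : prime p) (p4 : (p %% 4 = 1)%N) :
  paley_gauss R p ^+ 2 = p%:R.
Proof.
have p2 := prime_mod4_gt2 p_pr p4; have [i iE] := Fp_sqrtN1 p_pr p4.
rewrite -[in RHS](card_Fp p_pr).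
apply: (quad_gauss_sqr (Fp_two_neq0 p_pr p2) iE (Fp_cos0 R p) (sum_Fp_cos R p_pr p2)).
by move=> u v; rewrite Fp_cosB // (proj1 (Fp_cosD R p_pr u v)); ring.
Qed.

(** For nonzero [a], counting square roots gives each [z] the weight [1 + legendre z]: the constant
    part sums to 0 and the rest is a twisted Gauss sum. *)
Lemma sum_Fp_cos_sqr (R : realType) (p : nat) (p_pr : prime p) (p4 : (p %% 4 = 1)%N)
    (a : 'F_p) :
  \sum_(y : 'F_p) Fp_cos (a * y ^+ 2) =
    p%:R * (a == 0)%:R + (legendre a)%:~R * paley_gauss R p.
Proof.
have p2 := prime_mod4_gt2 p_pr p4.
have [->|a0] := eqVneq a 0.
  under eq_bigr do rewrite mul0r Fp_cos0.
  by rewrite sumr_const card_Fp // /legendre eqxx mul0r addr0 mulr1.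
rewrite (sum_sqr_quad_char (Fp_two_neq0 p_pr p2) (fun z => Fp_cos (a * z))).
under eq_bigr do rewrite mulrDl mul1r.
rewrite big_split /= (sum_scaled (sum_Fp_cos R p_pr p2) a0) quad_gauss_twist //.
by rewrite mulr0.
Qed.

(** * The squared norm of the image under the Paley matrix *)

Lemma sum_ord_Fp (V : nmodType) (p : nat) (p_pr : prime p) (f : nat -> V) :
  \sum_(i < p) f i = \sum_(a : 'F_p) f a.
Proof. by rewrite -(big_mkord xpredT f) -{1}(Fp_cast p_pr) big_mkord. Qed.

(** Pairs [i] with [h.*2.+1 - i]. For [p = h.*2.+1] the residues [i] and [p - i] have the same
    square, and the matrix has one row for each such pair. *)
Lemma sum_symmetric (R : nmodType) (h : nat) (f : nat -> R) :
  (forall i, (0 < i <= h)%N -> f (h.*2.+1 - i)%N = f i) ->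
  \sum_(i < h.*2.+1) f i = f 0%N + \sum_(i < h) f i.+1 *+ 2.
Proof.
move=> fS; rewrite big_ord_recl; congr (_ + _).
rewrite -(big_mkord xpredT (fun i => f i.+1)) -addnn.
rewrite (big_cat_nat (leq0n h) (leq_addr h h)) /= big_mkord.
under [RHS]eq_bigr do rewrite mulr2n.
rewrite big_split /=; congr (_ + _).
rewrite -{1}[h]add0n big_addn addnK big_mkord (reindex_inj rev_ord_inj) /=.
apply: eq_bigr => i _; rewrite -(fS i.+1); last by have := ltn_ord i; lia.
by congr f; have := ltn_ord i; lia.
Qed.

(** The squared modulus of the Fourier coefficient of [X] at frequency [c]. *)
Definition Fp_power (R : realType) (p : nat) (X : 'F_p -> R) (c : 'F_p) : R :=
  (\sum_(a : 'F_p) Fp_cos (c * a) * X a) ^+ 2 + (\sum_(a : 'F_p) Fp_sin (c * a) * X a) ^+ 2.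

Lemma Fp_powerE (R : realType) (p : nat) (p_pr : prime p) (X : 'F_p -> R) (c : 'F_p) :
  Fp_power X c = \sum_(a : 'F_p) \sum_(b : 'F_p) X a * X b * Fp_cos (c * (a - b)).
Proof.
rewrite /Fp_power !expr2 !mulr_suml -big_split; apply: eq_bigr => a _ /=.
rewrite !mulr_sumr -big_split; apply: eq_bigr => b _ /=.
by rewrite mulrBr Fp_cosB //; ring.
Qed.

Lemma sum_ord_recr_Fp (R : realType) (p : nat) (p_pr : prime p) (x : 'I_p.+1 -> R) (f : nat -> R) :
  \sum_(j < p.+1) f j * x j = \sum_(a : 'F_p) f a * x (inord a) + f p * x ord_max.
Proof.
rewrite big_ord_recr /=; congr (_ + _).
rewrite -(sum_ord_Fp p_pr (fun j => f j * x (inord j))).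
by apply: eq_bigr => j _; congr (_ * x _); apply: val_inj; rewrite /= inordK // ltnS ltnW.
Qed.

Lemma sum_sqr_recr_Fp (R : realType) (p : nat) (p_pr : prime p) (x : 'I_p.+1 -> R) :
  \sum_j x j ^+ 2 = \sum_(a : 'F_p) x (inord a) ^+ 2 + x ord_max ^+ 2.
Proof.
rewrite big_ord_recr /=; congr (_ + _).
rewrite -(sum_ord_Fp p_pr (fun j => x (inord j) ^+ 2)).
by apply: eq_bigr => j _; congr (x _ ^+ 2); apply: val_inj; rewrite /= inordK // ltnS ltnW.
Qed.

Lemma paley_angleE (R : realType) (p : nat) (p_pr : prime p) (i : nat) (a : 'F_p) :
  cos (paley_angle p i a) = Fp_cos (i%:R ^+ 2 * a) :> R /\
  sin (paley_angle p i a) = - Fp_sin (i%:R ^+ 2 * a) :> R.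
Proof.
have [cE sE] := Fp_cos_sin_nat R p_pr (i ^ 2 * a).
by rewrite /paley_angle cosN sinN cE sE natrM natrX natr_Zp.
Qed.

Lemma paley_row_re (R : realType) (p : nat) (p_pr : prime p) (x : 'I_p.+1 -> R)
    (i : nat) :
  \sum_(j < p.+1) paley_re p i j * x j =
    paley_scale p i * (\sum_(a : 'F_p) Fp_cos (i%:R ^+ 2 * a) * x (inord a))
    + (i == 0%N)%:R * x ord_max.
Proof.
rewrite (sum_ord_recr_Fp p_pr) {2}/paley_re ltnn mulr_sumr; congr (_ + _).
apply: eq_bigr => a _; rewrite /paley_re -{2}(Fp_cast p_pr) ltn_ord.
by rewrite (proj1 (paley_angleE R p_pr i a)) mulrA.
Qed.

Lemma paley_row_im (R : realType) (p : nat) (p_pr : prime p) (x : 'I_p.+1 -> R)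
    (i : nat) :
  \sum_(j < p.+1) paley_im p i j * x j =
    - (paley_scale p i * (\sum_(a : 'F_p) Fp_sin (i%:R ^+ 2 * a) * x (inord a))).
Proof.
rewrite (sum_ord_recr_Fp p_pr) {2}/paley_im ltnn mul0r addr0 mulr_sumr -sumrN.
apply: eq_bigr => a _; rewrite /paley_im -{2}(Fp_cast p_pr) ltn_ord.
by rewrite (proj2 (paley_angleE R p_pr i a)) mulrN mulNr mulrA.
Qed.

(** Summing over [y] first leaves cosine sums over squares: their delta term yields the diagonal,
    their Gauss term the character form. *)
Lemma sum_Fp_power (R : realType) (p : nat) (p_pr : prime p) (p4 : (p %% 4 = 1)%N)
    (X : 'F_p -> R) :
  \sum_(y : 'F_p) Fp_power X (y ^+ 2) = p%:R * \sum_(a : 'F_p) X a ^+ 2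
    + paley_gauss R p * \sum_(a : 'F_p) \sum_(b : 'F_p) (legendre (a - b))%:~R * (X a * X b).
Proof.
under eq_bigr do rewrite Fp_powerE //.
rewrite exchange_big !mulr_sumr -big_split; apply: eq_bigr => a _ /=.
rewrite exchange_big mulr_sumr /=.
under eq_bigr => b _.
  rewrite -mulr_sumr; under eq_bigr do rewrite mulrC.
  rewrite sum_Fp_cos_sqr // mulrDr.
over.
rewrite big_split /=; congr (_ + _); last by apply: eq_bigr => b _; ring.
rewrite (bigD1 a) //= subrr eqxx big1 ?addr0 => [|b ba]; first by rewrite mulr1; ring.
by rewrite subr_eq0 eq_sym (negPf ba) !mulr0.
Qed.

(* The Gram matrix of the Paley frame is [1 + p^(-1/2) C], where [C] is the
   Paley conference matrix with its last row and column as border, the inner block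
   being multiplied by the sign of the Gauss sum. *)
Lemma paley_normsqE (R : realType) (p : nat) (p_pr : prime p) (p4 : (p %% 4 = 1)%N)
    (x : 'I_p.+1 -> R) :
  paley_normsq x = \sum_j x j ^+ 2
    + 2 * Num.sqrt (1 / p%:R) * x ord_max * \sum_(a : 'F_p) x (inord a)
    + paley_gauss R p / p%:R *
      \sum_(a : 'F_p) \sum_(b : 'F_p) (legendre (a - b))%:~R * (x (inord a) * x (inord b)).
Proof.
pose X (a : 'F_p) : R := x (inord a).
have p0 : p%:R != 0 :> R by rewrite pnatr_eq0 -lt0n prime_gt0.
have [h pE] : exists h, p = h.*2.+1.
  by exists (p %/ 2)%N; move: p4; clear; lia.
have hE : (p.+1)./2 = h.+1 by rewrite pE; clear; lia.
have symP : \sum_(y : 'F_p) Fp_power X (y ^+ 2)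
    = Fp_power X 0 + \sum_(i < h) Fp_power X (i.+1%:R ^+ 2) *+ 2.
  transitivity (\sum_(y : 'F_p) Fp_power X ((y : nat)%:R ^+ 2)).
    by apply: eq_bigr => y _; rewrite natr_Zp.
  rewrite -(sum_ord_Fp p_pr (fun i => Fp_power X (i%:R ^+ 2))).
  rewrite -(big_mkord xpredT (fun i => Fp_power X (i%:R ^+ 2))) [X in index_iota 0 X]pE big_mkord.
  rewrite (sum_symmetric (f := fun i : nat => Fp_power X (i%:R ^+ 2))) ?expr0n // => i /andP[_ ih].
  rewrite -pE natrB; last by rewrite pE; move: ih; clear; lia.
  have -> : p%:R = 0 :> 'F_p by rewrite -(Fp_nat_mod p_pr) modnn.
  by rewrite sub0r sqrrN.
rewrite /paley_normsq hE big_ord_recl /= (sum_sqr_recr_Fp p_pr).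
rewrite !(paley_row_re p_pr) !(paley_row_im p_pr) /= expr0n /=.
have FP0 : Fp_power X 0 = (\sum_(a : 'F_p) X a) ^+ 2.
  rewrite /Fp_power; under eq_bigr do rewrite mul0r Fp_cos0 mul1r.
  by rewrite [X in _ + X ^+ 2]big1 ?expr0n ?addr0 // => a _; rewrite mul0r Fp_sin0 mul0r.
under eq_bigr do rewrite mul0r Fp_cos0 mul1r.
rewrite [X in - (_ * X)]big1; last by move=> a _; rewrite mul0r Fp_sin0 mul0r.
have rowE (i : 'I_h) :
    (\sum_(j < p.+1) paley_re p (bump 0 i) j * x j) ^+ 2 +
    (\sum_(j < p.+1) paley_im p (bump 0 i) j * x j) ^+ 2
    = 2 / p%:R * Fp_power X (i.+1%:R ^+ 2).
  rewrite !(paley_row_re p_pr) !(paley_row_im p_pr) /bump /= add1n mul0r addr0 sqrrN.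
  rewrite !exprMn -mulrDr /paley_scale /= sqr_sqrtr ?divr_ge0 ?ler0n //.
rewrite [X in _ + X = _](eq_bigr _ (fun i _ => rowE i)) -mulr_sumr.
move: symP; rewrite (sum_Fp_power p_pr p4) FP0 sumrMnl -[_ *+ 2]mulr_natl => symP.
have s2 : Num.sqrt (1 / p%:R) ^+ 2 = 1 / p%:R :> R by rewrite sqr_sqrtr // divr_ge0 ?ler0n.
rewrite /paley_scale /=.
move: s2 symP.
set s := Num.sqrt _; set A := \sum_(i < h) _; set G := paley_gauss _ _.
set U := \sum_(a : 'F_p) \sum_(b : 'F_p) _.
set T := \sum_(a : 'F_p) X a ^+ 2; set S := \sum_(a : 'F_p) X a => s2 symP.
(* The [- S ^+ 2] cancels the square [(s * S) ^+ 2] coming from row 0, of which only the cross term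
   with the last column remains. *)
have AE : 2 * A = p%:R * T + G * U - S ^+ 2 by rewrite symP; ring.
rewrite mulr0 oppr0 expr0n /= addr0 sqrrD exprMn s2.
rewrite [2 / _ * A]mulrAC AE.
by field.
Qed.

(** * From bounds over sets to bounds on quadratic forms *)

(** Lagrange's identity: twice the defect is a sum of squares. *)
Lemma cauchy_schwarz_sum (R : realFieldType) (I : finType) (P : pred I) (x y : I -> R) :
  (\sum_(i | P i) x i * y i) ^+ 2 <= (\sum_(i | P i) x i ^+ 2) * (\sum_(i | P i) y i ^+ 2).
Proof.
have : 0 <= \sum_(i | P i) \sum_(j | P j) (x i * y j - x j * y i) ^+ 2.
  by apply: sumr_ge0 => i _; apply: sumr_ge0 => j _; exact: sqr_ge0.
suff -> : \sum_(i | P i) \sum_(j | P j) (x i * y j - x j * y i) ^+ 2 =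
    2 * ((\sum_(i | P i) x i ^+ 2) * (\sum_(i | P i) y i ^+ 2)
         - (\sum_(i | P i) x i * y i) ^+ 2).
  by rewrite pmulr_rge0 // subr_ge0.
rewrite mulrBr mulr_natl mulr2n {2}[_ * \sum_(i | P i) y i ^+ 2]mulrC expr2.
rewrite !mulr_suml mulr_sumr -big_split -sumrB; apply: eq_bigr => i _ /=.
rewrite !mulr_sumr -big_split -sumrB; apply: eq_bigr => j _ /=.
by ring.
Qed.

Definition harmonic_sum (R : fieldType) (n : nat) : R := \sum_(k < n) k.+1%:R^-1.

(* Removing an entry of least absolute value: it is at most [sqrt (2 c / #|S|)]. *)
Lemma sum_sqr_flat (R : realFieldType) (T : finType) (l : T -> R) (c : R) (S : {set T}) :
  (forall A : {set T}, A \subset S -> (\sum_(a in A) l a) ^+ 2 <= c * #|A|%:R) ->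
  \sum_(a in S) l a ^+ 2 <= 2 * c * harmonic_sum R #|S|.
Proof.
have [n] := ubnP #|S|; elim: n S => // n IH S Sn lS.
have [->|[j0 j0S]] := set_0Vmem S.
  by rewrite big_set0 cards0 /harmonic_sum big_ord0 mulr0.
case: (arg_minP (fun j => `|l j|) j0S) => j jS0 jmin {j0 j0S}; have jS : j \in S by [].
have cardS : #|S| = #|S :\ j|.+1 by rewrite (cardsD1 j) jS.
rewrite (big_setD1 j) //= cardS /harmonic_sum big_ord_recr /= -cardS mulrDr addrC.
apply: lerD.
  apply: IH => [|A AS]; first by rewrite -ltnS -cardS.
  by apply: lS; exact: fintype.subset_trans AS (finset.subsetDl _ _).
have S0 : 0 < #|S|%:R :> R by rewrite cardS ltr0n.
(* Splitting by sign, the hypothesis applies to [P] and to [N], and [(u - v)^2 <= 2 (u^2 + v^2)]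
   bounds the sum of absolute values. *)
pose P := S :&: [set a | 0 <= l a]; pose N := S :\: [set a | 0 <= l a].
have abs_sum : \sum_(a in S) `|l a| = \sum_(a in P) l a - \sum_(a in N) l a.
  rewrite (big_setID [set a | 0 <= l a]) /= -sumrN; congr (_ + _).
    by apply: eq_bigr => a; rewrite !inE => /andP[_ /ger0_norm].
  by apply: eq_bigr => a; rewrite !inE -ltNge => /andP[/ltr0_norm].
have lbound : #|S|%:R * `|l j| <= \sum_(a in S) `|l a|.
  by rewrite mulr_natl -sumr_const; apply: ler_sum => a /jmin.
have cardPN : #|S|%:R = #|P|%:R + #|N|%:R :> R by rewrite -natrD cardsID.
have := lS P (finset.subsetIl _ _); have := lS N (finset.subsetDl _ _).
move: lbound; rewrite abs_sum.
set u := \sum_(a in P) _; set v := \sum_(a in N) _ => lb vc uc.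
have key : (#|S|%:R * `|l j|) ^+ 2 <= 2 * c * #|S|%:R.
  apply: (@le_trans _ _ ((u - v) ^+ 2)).
    rewrite ler_sqr // nnegrE ?mulr_ge0 //.
    by apply: le_trans lb; rewrite mulr_ge0.
  have := sqr_ge0 (u + v); rewrite cardPN; nra.
rewrite -(ler_pM2r S0) divfK ?gt_eqF // -(ler_pM2r S0).
by move: key; rewrite exprMn -normrX ger0_norm ?sqr_ge0 // mulrC expr2 mulrA.
Qed.

(** For fixed [B] the row sums of [C] over [B] are flat with constant [M * #|B|]. By [sum_sqr_flat]
    and Cauchy-Schwarz the vector [m] is then flat with constant [X * (2 * M * H)], and the same two
    tools in the other variable finish. *)
Lemma bilinear_flat (R : realFieldType) (T : finType) (C : T -> T -> R) (M : R)
    (S : {set T}) (x : T -> R) :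
  (forall A B : {set T}, A \subset S -> B \subset S ->
    (\sum_(a in A) \sum_(b in B) C a b) ^+ 2 <= M * #|A|%:R * #|B|%:R) ->
  (\sum_(a in S) \sum_(b in S) C a b * (x a * x b)) ^+ 2 <=
    4 * M * harmonic_sum R #|S| ^+ 2 * (\sum_(a in S) x a ^+ 2) ^+ 2.
Proof.
move=> CM; set H := harmonic_sum R #|S|; set X := \sum_(a in S) x a ^+ 2.
have X0 : 0 <= X by apply: sumr_ge0 => a _; exact: sqr_ge0.
have H0 : 0 <= H by apply: sumr_ge0 => a _; rewrite invr_ge0.
pose m b := \sum_(a in S) x a * C a b.
have mB (B : {set T}) : B \subset S ->
    (\sum_(b in B) m b) ^+ 2 <= X * (2 * M * H) * #|B|%:R.
  move=> BS; rewrite /m exchange_big /=.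
  under eq_bigr do rewrite -mulr_sumr.
  apply: le_trans (cauchy_schwarz_sum _ _ _) _; rewrite -mulrA ler_wpM2l //.
  apply: (@le_trans _ _ (2 * (M * #|B|%:R) * H)); last by rewrite le_eqVlt; apply/orP; left; apply/eqP; ring.
  by apply: sum_sqr_flat => A AS; rewrite mulrAC; exact: CM.
have -> : \sum_(a in S) \sum_(b in S) C a b * (x a * x b) = \sum_(b in S) x b * m b.
  rewrite exchange_big; apply: eq_bigr => b _; rewrite mulr_sumr.
  by apply: eq_bigr => a _; ring.
apply: le_trans (cauchy_schwarz_sum _ _ _) _; rewrite -/X.
apply: (@le_trans _ _ (X * (2 * (X * (2 * M * H)) * H))).
  by rewrite ler_wpM2l //; exact: sum_sqr_flat.
by rewrite le_eqVlt; apply/orP; left; apply/eqP; ring.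
Qed.

(** Polarization for sets that may overlap, where the sum of the indicators is no indicator:
    everything is expanded into blocks over [A :&: B], [A :\: B] and [B :\: A]. *)
Lemma symmetric_sum_setUI (R : comNzRingType) (T : finType) (C : T -> T -> R) (A B : {set T})
    (q := fun X : {set T} => \sum_(a in X) \sum_(b in X) C a b) :
  (forall a b, C a b = C b a) ->
  2 * \sum_(a in A) \sum_(b in B) C a b
    = q (A :|: B) + q (A :&: B) - q (A :\: B) - q (B :\: A).
Proof.
move=> Csym; pose E (X Y : {set T}) := \sum_(a in X) \sum_(b in Y) C a b.
have EC X Y : E X Y = E Y X.
  by rewrite /E exchange_big; apply: eq_bigr => b _; apply: eq_bigr => a _.
have El (X Y Z : {set T}) : E X Z = E (X :&: Y) Z + E (X :\: Y) Z.
  by rewrite /E -big_setID.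
rewrite -/(E A B) /q -!/(E _ _).
have UA : (A :|: B) :&: A = A by apply/setP=> x; rewrite !inE; case: (x \in A); rewrite ?andbF.
have UB : (A :|: B) :\: A = B :\: A by apply/setP=> x; rewrite !inE; case: (x \in A).
have lA X : E A X = E (A :&: B) X + E (A :\: B) X by exact: El.
have lB X : E B X = E (A :&: B) X + E (B :\: A) X by rewrite finset.setIC; exact: El.
have lU X : E (A :|: B) X = E A X + E (B :\: A) X by rewrite (El _ A) UA UB.
have rA X : E X A = E X (A :&: B) + E X (A :\: B) by rewrite EC lA !(EC X).
have rB X : E X B = E X (A :&: B) + E X (B :\: A) by rewrite EC lB !(EC X).
have rU X : E X (A :|: B) = E X A + E X (B :\: A) by rewrite EC lU !(EC X).
rewrite lU !rU !lA !rA !rB (EC (B :\: A) (A :&: B)) (EC (B :\: A) (A :\: B)).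
by rewrite (EC (A :\: B) (A :&: B)); ring.
Qed.

(** * Comparison of harmonic sums, logarithms and powers *)

(** Induction: [ln (1 - v) <= - v] at [v = 1 / (n + 2)] bounds the new term by
    [ln (n + 2) - ln (n + 1)]. *)
Lemma harmonic_sum_le_ln (R : realType) (n : nat) :
  (0 < n)%N -> harmonic_sum R n <= 1 + ln n%:R.
Proof.
case: n => // n _; elim: n => [|n IH].
  by rewrite /harmonic_sum big_ord1 invr1 ln1 addr0.
rewrite /harmonic_sum big_ord_recr /=.
apply: (@le_trans _ _ (1 + ln n.+1%:R + n.+2%:R^-1)); first by rewrite lerD2r.
rewrite -addrA lerD2l.
have n2 : n.+2%:R^-1 < 1 :> R by rewrite invf_lt1 ?ltr1n ?ltr0n.
have -> : n.+1%:R = n.+2%:R * (1 + - n.+2%:R^-1) :> R.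
  by rewrite mulrDr mulrN mulfV ?pnatr_eq0 // mulr1 -[n.+2]addn1 natrD addrK.
rewrite lnM ?posrE ?ltr0n ?subr_gt0 //.
have := @le_ln1Dx R (- n.+2%:R^-1); rewrite ltrN2 => /(_ n2) lnv.
by rewrite -addrA gerDl -[leRHS](addNr n.+2%:R^-1) lerD2r.
Qed.

(** With [w = p^(eta / 2)] one has [ln p <= (2 / eta) w], so the left side is at most [E * w], and
    this is below [w * w] once [w] exceeds [E]. The case [D = 0] serves to absorb constants. *)
Lemma ln_lt_powR_near (R : realType) (C D eta : R) : 0 < eta -> 0 <= D ->
  exists P0 : nat, forall p : nat, (P0 <= p)%N -> C + D * ln p%:R < p%:R `^ eta.
Proof.
move=> eta0 D0; pose E := `|C| + D * (2 / eta) + 1.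
have E0 : 0 < E.
  by rewrite ltr_wpDl // addr_ge0 // mulr_ge0 // divr_ge0 // ltW.
have [P0 P0E] : exists P0 : nat, E `^ (2 / eta) < P0%:R.
  exists (Num.truncn (E `^ (2 / eta))).+1; exact: truncnS_gt.
exists (maxn 1 P0) => p; rewrite geq_max => /andP[p1 P0p].
have p1R : 1 <= p%:R :> R by rewrite ler1n.
have p0R : 0 < p%:R :> R by apply: lt_le_trans p1R.
set w : R := p%:R `^ (eta / 2).
have w1 : 1 <= w by rewrite /w -[leLHS](powRr0 p%:R) ler_powR // divr_ge0 // ltW.
have wE : E < w.
  have -> : E = (E `^ (2 / eta)) `^ (eta / 2).
    rewrite -powRrM (_ : 2 / eta * (eta / 2) = 1) ?powRr1 ?ltW //.
    by field; rewrite gt_eqF.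
  apply: gt0_ltr_powR; rewrite ?nnegrE ?powR_ge0 ?divr_gt0 ?ltW //.
  by apply: (lt_le_trans P0E); rewrite ler_nat.
have lnw : ln p%:R <= (2 / eta) * w.
  have -> : ln p%:R = (2 / eta) * ln w.
    by rewrite /w ln_powR mulrA (_ : 2 / eta * (eta / 2) = 1) ?mul1r //; field; rewrite gt_eqF.
  rewrite ler_wpM2l ?divr_ge0 ?(ltW eta0) //; apply/ltW/ln_sublinear.
  by apply: lt_le_trans w1.
have -> : p%:R `^ eta = w * w.
  rewrite /w -powRD; first by congr (_ `^ _); field.
  by rewrite (gt_eqF p0R) implybT.
apply: (@le_lt_trans _ _ (E * w)); last by rewrite ltr_pM2r // (lt_le_trans _ w1).
apply: (@le_trans _ _ (`|C| * w + D * (2 / eta * w))).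
  apply: lerD; last by rewrite ler_wpM2l.
  by apply: le_trans (ler_norm C) _; rewrite ler_peMr.
rewrite /E; nra.
Qed.

(** * Character sums over sets and the deviation of the norm *)

Lemma legendre_subC (p : nat) (p_pr : prime p) (p4 : (p %% 4 = 1)%N) (a b : 'F_p) :
  legendre (a - b) = legendre (b - a).
Proof. by have [i iE] := Fp_sqrtN1 p_pr p4; rewrite -opprB -[LHS](quad_charN iE) opprK. Qed.

Lemma normr_legendre_le1 (R : realType) (p : nat) (a : 'F_p) :
  `|(legendre a)%:~R : R| <= 1.
Proof.
by rewrite /legendre; case: ifP => _; [rewrite normr0 | case: ifP => _; rewrite ?normrN normr1].
Qed.

Definition paley_edge_sum (R : realType) (p : nat) (A B : {set 'F_p}) : R :=
  \sum_(a in A) \sum_(b in B) (legendre (a - b))%:~R.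

(** Polarization bounds twice the edge sum by four terms of size [M / 2], hence the edge sum by [M];
    the second factor is bounded trivially by [#|A| * #|B|]. *)
Lemma paley_edge_sum_flat (R : realType) (p : nat) (p_pr : prime p) (p4 : (p %% 4 = 1)%N)
    (S : {set 'F_p}) (M : R) :
  (forall X : {set 'F_p}, X \subset S -> `|paley_edge_sum R X X| <= M / 2) ->
  forall A B : {set 'F_p}, A \subset S -> B \subset S ->
    paley_edge_sum R A B ^+ 2 <= M * #|A|%:R * #|B|%:R.
Proof.
move=> qS A B AS BS.
have triv : `|paley_edge_sum R A B| <= #|A|%:R * #|B|%:R.
  apply: le_trans (ler_norm_sum _ _ _) _.
  rewrite mulr_natl -sumr_const; apply: ler_sum => a _.
  apply: le_trans (ler_norm_sum _ _ _) _.
  by rewrite -sumr_const; apply: ler_sum => b _; exact: normr_legendre_le1.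
have eM : `|paley_edge_sum R A B| <= M.
  have := symmetric_sum_setUI A B
    (fun a b => congr1 (fun z : int => z%:~R : R) (legendre_subC p_pr p4 a b)).
  rewrite -!/(paley_edge_sum R _ _).
  have ABS : A :|: B \subset S by rewrite finset.subUset AS.
  have := qS _ ABS.
  have := qS _ (fintype.subset_trans (finset.subsetIl A B) AS).
  have := qS _ (fintype.subset_trans (finset.subsetDl A B) AS).
  have := qS _ (fintype.subset_trans (finset.subsetDl B A) BS).
  rewrite !ler_norml => /andP[? ?] /andP[? ?] /andP[? ?] /andP[? ?] ?; apply/andP; split; lra.
by rewrite -real_normK ?num_real // expr2 -mulrA; exact: ler_pM.
Qed.

(** The [k] term comes from the border, by Cauchy-Schwarz on the support, and the [N] term from the
    character block, by [bilinear_flat] with [M = N ^+ 2]. Stating the hypotheses with squares keeps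
    roots out of the bound. *)
Lemma paley_normsq_dev (R : realType) (p : nat) (p_pr : prime p) (p4 : (p %% 4 = 1)%N)
    (x : 'I_p.+1 -> R) (k N : R) :
  0 <= k -> 0 <= N -> #|[set j | x j != 0]|%:R <= k ^+ 2 ->
  (forall X : {set 'F_p}, #|X|%:R <= k ^+ 2 -> `|paley_edge_sum R X X| <= N ^+ 2 / 2) ->
  `|paley_normsq x - \sum_j x j ^+ 2| <=
    Num.sqrt (1 / p%:R) * (k + 2 * N * (1 + ln p%:R)) * \sum_j x j ^+ 2.
Proof.
move=> k0 N0 xk qN; rewrite (paley_normsqE p_pr p4) addrC -addrA addKr.
rewrite (sum_sqr_recr_Fp p_pr).
have p0 : 0 < p%:R :> R by rewrite ltr0n prime_gt0.
pose X (a : 'F_p) := x (inord a); pose S := [set a | X a != 0].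
have Sk : #|S|%:R <= k ^+ 2.
  apply: le_trans xk; rewrite ler_nat -(card_in_imset (f := fun a : 'F_p => inord a : 'I_p.+1)).
    by apply: subset_leq_card; apply/fintype.subsetP => j /imsetP[a]; rewrite !inE => aS ->.
  move=> a b _ _ /(congr1 val) /=.
  have lt_p (c : 'F_p) : (c < p.+1)%N by have := ltn_ord c; rewrite {2}(Fp_cast p_pr) => /ltnW.
  by rewrite !inordK // => /val_inj.
have X0 a : a \notin S -> X a = 0 by rewrite inE negbK => /eqP.
have S_sum (f : 'F_p -> R) : (forall a, X a = 0 -> f a = 0) -> \sum_a f a = \sum_(a in S) f a.
  by move=> f0; rewrite [LHS](bigID (mem S)) /= [X in _ + X]big1 ?addr0 // => a /X0/f0.
set T := \sum_a X a ^+ 2; set U := \sum_a X a; set Q := \sum_a \sum_b _.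
have TE : T = \sum_(a in S) X a ^+ 2 by apply: S_sum => a ->; rewrite expr0n.
have T0 : 0 <= T by apply: sumr_ge0 => a _; exact: sqr_ge0.
have UT : U ^+ 2 <= k ^+ 2 * T.
  rewrite /U S_sum // TE.
  have := cauchy_schwarz_sum (mem S) (fun=> 1) X.
  under eq_bigr do rewrite mul1r.
  rewrite [X in _ <= X * _](eq_bigr (fun=> 1)) ?sumr_const => [/le_trans->//|a _]; last by rewrite expr1n.
  by rewrite ler_wpM2r // -TE.
have L1 : harmonic_sum R #|S| <= 1 + ln p%:R.
  have lnp : 0 <= ln p%:R :> R by rewrite ln_ge0 // ler1n prime_gt0.
  have [S0|S0] := posnP #|S|; first by rewrite S0 /harmonic_sum big_ord0 addr_ge0.
  apply: le_trans (harmonic_sum_le_ln R S0) _; rewrite lerD2l ler_ln ?posrE ?ltr0n ?(prime_gt0 p_pr) //.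
  by rewrite ler_nat; apply: leq_trans (max_card _) _; rewrite card_Fp.
have H0 : 0 <= harmonic_sum R #|S| by apply: sumr_ge0 => i _; rewrite invr_ge0.
have QT : `|Q| <= 2 * N * (1 + ln p%:R) * T.
  have -> : Q = \sum_(a in S) \sum_(b in S) (legendre (a - b))%:~R * (X a * X b).
    rewrite /Q S_sum => [|a Xa]; last by rewrite big1 // => b _; rewrite -/(X a) Xa mul0r mulr0.
    by apply: eq_bigr => a _; apply: S_sum => b Xb; rewrite -/(X b) Xb !mulr0.
  have qS (Y : {set 'F_p}) : Y \subset S -> `|paley_edge_sum R Y Y| <= N ^+ 2 / 2.
    by move=> /subset_leq_card YS; apply: qN; apply: le_trans Sk; rewrite ler_nat.
  have := bilinear_flat X (paley_edge_sum_flat p_pr p4 qS).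
  rewrite -TE => Qb.
  apply: (@le_trans _ _ (2 * N * harmonic_sum R #|S| * T)); last first.
    by apply: ler_wpM2r => //; apply: ler_wpM2l; [rewrite mulr_ge0 | exact: L1].
  rewrite -ler_sqr ?nnegrE ?mulr_ge0 // real_normK ?num_real //.
  by apply: le_trans Qb _; rewrite le_eqVlt; apply/orP; left; apply/eqP; ring.
set s := Num.sqrt _; have s0 : 0 <= s by exact: sqrtr_ge0.
have gs : `|paley_gauss R p / p%:R| = s.
  rewrite /s -sqrtr_sqr expr_div_n paley_gauss_sqr //; congr Num.sqrt.
  by field; rewrite gt_eqF.
set y := x ord_max.
apply: le_trans (ler_normD _ _) _; rewrite [X in _ + X <= _]normrM gs.
have cross : `|2 * s * y * U| <= s * k * (T + y ^+ 2).
  have -> : 2 * s * y * U = s * (2 * y * U) by ring.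
  rewrite normrM ger0_norm // -[leRHS]mulrA ler_wpM2l //.
  (* For [k > 0] the bound is [2 |y U| <= k y^2 + U^2 / k]; for [k = 0] the sum [U] vanishes. *)
  have [k00|k00] := eqVneq k 0.
    have /eqP : U ^+ 2 = 0 by apply/eqP; rewrite eq_le sqr_ge0 andbT (le_trans UT) // k00 expr0n mul0r.
    by rewrite expf_eq0 /= => /eqP ->; rewrite mulr0 normr0 k00 mul0r.
  have kp : 0 < k by rewrite lt_neqAle eq_sym k00.
  have := sqr_ge0 (k * y - U); have := sqr_ge0 (k * y + U).
  by move=> ? ?; rewrite ler_norml; apply/andP; split; rewrite -(ler_pM2l kp); nra.
(* The block bound only involves [T]; this nonnegative term pads it to [T + y ^+ 2]. *)
have := mulr_ge0 s0 (mulr_ge0 (mulr_ge0 (mulr_ge0 (ler0n _ 2) N0) (le_trans H0 L1)) (sqr_ge0 y)).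
have := ler_wpM2l s0 QT; move: cross; lra.
Qed.

Lemma sqrt_invr_powR (R : realType) (p : nat) : (0 < p)%N ->
  Num.sqrt (1 / p%:R) = p%:R `^ (- (1 / 2)) :> R.
Proof.
by move=> p0; rewrite -powR12_sqrt ?divr_ge0 // [1 / p%:R]div1r -[p%:R^-1]powR_inv1 // -powRrM; congr (_ `^ _); field.
Qed.

(** * The discrepancy bound implies the isometry property *)

Lemma discrepancy_RIP (R : realType) : stmtA R -> stmtB R.
Proof.
move=> [al [be [/andP[al0 al2] [/andP[be0 be2] [P0 disc]]]]].
pose gm : R := 1 / 2 + be / 8.
(* The three entries cover small sets (trivial bound), large sets (since
   [gm * (2 - be) <= 2 * (1 / 2 - be / 8)]) and the border term; all lie below [1 / 2]. *)
pose sg : R := Num.max al (Num.max (1 / 2 - be / 8) (gm / 2)).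
have [sg_al sg_be sg_gm] : [/\ al <= sg, 1 / 2 - be / 8 <= sg & gm / 2 <= sg].
  by rewrite /sg !le_max !lexx !orbT.
have sg2 : sg < 1 / 2 by rewrite /sg !gt_max /gm; apply/and3P; split; lra.
pose tau := (sg + 1 / 2) / 2.
exists gm, tau; split; [by rewrite /gm; lra | split; [by rewrite /tau; lra |]] => eps eps0.
(* With [k <= p^sg] and [N = 2 p^sg], the factor [k + 2 N (1 + ln p)] is at most
   [p^sg (5 + 4 ln p)]. *)
have [| |P1 P1E] := @ln_lt_powR_near R 5 4 (tau - sg); first by rewrite /tau; lra.
  by [].
exists (maxn P0 P1) => p p_pr p4; rewrite geq_max => /andP[P0p P1p] x xK.
have p0 : 0 < p%:R :> R by rewrite ltr0n prime_gt0.
have p1 : 1 <= p%:R :> R by rewrite ler1n prime_gt0.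
have powD (a b : R) : p%:R `^ (a + b) = p%:R `^ a * p%:R `^ b.
  by rewrite powRD // (gt_eqF p0) implybT.
have pow2 (a : R) : (p%:R `^ a) ^+ 2 = p%:R `^ (2 * a) by rewrite expr2 -powD; congr (_ `^ _); ring.
have dev : `|paley_normsq x - \sum_j x j ^+ 2| <= p%:R `^ (tau - 1 / 2 + eps) * \sum_j x j ^+ 2.
  apply: le_trans (paley_normsq_dev (k := p%:R `^ (gm / 2)) (N := 2 * p%:R `^ sg) p_pr p4 _ _ _ _) _.
  - exact: powR_ge0.
  - by rewrite mulr_ge0 ?powR_ge0.
  - by rewrite pow2 (_ : 2 * (gm / 2) = gm) //; field.
  - move=> X; rewrite exprMn !pow2 (_ : 2 * (gm / 2) = gm) => [XK|]; last by field.
    have -> : 2 ^+ 2 * p%:R `^ (2 * sg) / 2 = p%:R `^ (2 * sg) + p%:R `^ (2 * sg) :> R by field.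
    (* Sets too small for the discrepancy hypothesis are handled by the trivial bound [#|X|^2]. *)
    have [Xs|Xl] := leP #|X|%:R (p%:R `^ al : R).
      apply: (@le_trans _ _ (p%:R `^ (2 * sg))); last by rewrite lerDl powR_ge0.
      apply: (@le_trans _ _ (#|X|%:R * #|X|%:R)).
        apply: le_trans (ler_norm_sum _ _ _) _.
        rewrite mulr_natl -sumr_const; apply: ler_sum => a _.
        apply: le_trans (ler_norm_sum _ _ _) _.
        by rewrite -sumr_const; apply: ler_sum => b _; exact: normr_legendre_le1.
      rewrite -pow2 expr2; apply: ler_pM => //; apply: le_trans Xs _; exact: ler_powR.
    apply: (@le_trans _ _ (p%:R `^ (2 * sg))); last by rewrite lerDl powR_ge0.
    have -> : paley_edge_sum R X X = (\sum_(a in X) \sum_(b in X) legendre (a - b))%:~R.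
      by rewrite rmorph_sum; apply: eq_bigr => a _; rewrite rmorph_sum.
    rewrite -intr_norm; apply: le_trans (ltW (disc p p_pr p4 P0p X Xl)) _.
    apply: (@le_trans _ _ ((p%:R `^ gm) `^ (2 - be))).
      by apply: ge0_ler_powR; rewrite ?nnegrE ?powR_ge0 //; lra.
    rewrite -powRrM ler_powR // /gm; nra.
  apply: ler_wpM2r; first by apply: sumr_ge0 => j _; exact: sqr_ge0.
  rewrite sqrt_invr_powR ?prime_gt0 //.
  apply: (@le_trans _ _ (p%:R `^ (- (1 / 2)) * p%:R `^ tau)); last first.
    by rewrite -powD ler_powR //; lra.
  rewrite ler_wpM2l ?powR_ge0 //.
  have -> : p%:R `^ tau = p%:R `^ sg * p%:R `^ (tau - sg) :> R.
    by rewrite -powD; congr (_ `^ _); ring.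
  apply: (@le_trans _ _ (p%:R `^ sg * (5 + 4 * ln p%:R))); last first.
    by apply: ler_wpM2l; [exact: powR_ge0 | apply/ltW; exact: P1E].
  have : p%:R `^ (gm / 2) <= p%:R `^ sg :> R by exact: ler_powR.
  lra.
move: dev; move: (_ `^ _) (paley_normsq x) (\sum_j _) => d N T.
by rewrite ler_norml => /andP[d1 d2]; split; lra.
Qed.

(** * The isometry property bounds cliques *)

Lemma RIP_clique (R : realType) : stmtB R -> stmtC R.
Proof.
move=> [gm [tau [gm2 [tau2 RIP]]]].
(* Nonnegativity of [t] ensures [1 <= p^(t + e / 2)], needed to absorb an additive 1 at the end. *)
pose t : R := Num.max tau 0.
have [t_tau t0] : tau <= t /\ 0 <= t by rewrite /t !le_max !lexx orbT.
have t2 : t < 1 / 2 by rewrite /t gt_max tau2 /=; lra.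
exists t; split=> // eps eps0.
(* Capping [e] keeps [t + e <= 1 / 2], so that the test set, of size at most
   [p^(t + e) + 1 <= 2 p^(1 / 2)], stays below [p^gm]. *)
pose e : R := Num.min eps (1 / 2 - t).
have e0 : 0 < e by rewrite /e lt_min eps0 /=; lra.
have [e_eps e_t] : e <= eps /\ t + e <= 1 / 2.
  by split; [rewrite /e ge_min lexx | have : e <= 1 / 2 - t by rewrite /e ge_min lexx orbT]; lra.
have [P0 P0E] := RIP _ (divr_gt0 e0 (ltr0n _ 2)).
have [| |P1 P1E] := @ln_lt_powR_near R 2 0 (e / 2); [by rewrite divr_gt0| by [] |].
have [| |P2 P2E] := @ln_lt_powR_near R 2 0 (gm - 1 / 2); [by rewrite subr_gt0| by [] |].
exists (maxn P0 (maxn P1 P2)) => p p_pr p4.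
rewrite !geq_max => /andP[P0p /andP[P1p P2p]] S cliqueS.
have p0 : 0 < p%:R :> R by rewrite ltr0n prime_gt0.
have p1 : 1 <= p%:R :> R by rewrite ler1n prime_gt0.
have powD (a b : R) : p%:R `^ (a + b) = p%:R `^ a * p%:R `^ b.
  by rewrite powRD // (gt_eqF p0) implybT.
apply: (@le_trans _ _ (p%:R `^ (t + e))); last by rewrite ler_powR // lerD2l.
rewrite leNgt; apply/negP => Sbig.
pose n := (Num.truncn (p%:R `^ (t + e) : R)).+1.
have nE : p%:R `^ (t + e) < n%:R :> R by exact: truncnS_gt.
have nE1 : n%:R <= p%:R `^ (t + e) + 1 :> R.
  by rewrite /n -addn1 natrD lerD2r truncn_le ?powR_ge0.
have nS : (n <= #|S|)%N.
  rewrite -ltnS ltnNge; apply/negP => Sn.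
  have : #|S|.+1%:R <= n%:R :> R by rewrite ler_nat.
  rewrite -addn1 natrD; lra.
have [T TS cardT] : exists2 T : {set 'F_p}, T \subset S & #|T| = n.
  exists [set a in take n (enum S)].
    by apply/fintype.subsetP => a; rewrite inE => /mem_take; rewrite mem_enum.
  have := card_uniqP (take_uniq n (enum_uniq S)); rewrite cardsE => ->.
  by rewrite size_takel // -cardE.
pose x (j : 'I_p.+1) : R := ((j < p)%N && ((j : nat)%:R \in T))%:R.
have lt_p (a : 'F_p) : (a < p)%N by have := ltn_ord a; rewrite {2}(Fp_cast p_pr).
have xa (a : 'F_p) : x (inord a) = (a \in T)%:R.
  by rewrite /x inordK ?natr_Zp ?lt_p // ltnS ltnW ?lt_p.
have xp : x ord_max = 0 by rewrite /x /= ltnn.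
have sumx : \sum_j x j ^+ 2 = n%:R.
  rewrite (sum_sqr_recr_Fp p_pr) xp expr0n addr0 -cardT -[RHS]sumr_const [RHS]big_mkcond /=.
  by apply: eq_bigr => a _; rewrite xa; case: (a \in T); rewrite ?expr1n ?expr0n.
have xK : #|[set j | x j != 0]|%:R <= p%:R `^ gm :> R.
  have -> : #|[set j | x j != 0]|%:R = n%:R :> R.
    rewrite -sumx -[LHS]sumr_const [LHS]big_mkcond /=; apply: eq_bigr => j _.
    by rewrite inE /x; case: (_ && _); rewrite ?oner_eq0 ?eqxx ?expr1n ?expr0n.
  apply: le_trans nE1 _; rewrite -(subrK (1 / 2) gm) [leRHS]powD.
  have h1 : p%:R `^ (t + e) <= p%:R `^ (1 / 2) :> R by exact: ler_powR.
  have h2 : 1 <= p%:R `^ (1 / 2) :> R by rewrite -[leLHS](powRr0 p%:R) ler_powR // divr_ge0.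
  have := P2E p P2p; rewrite mul0r addr0 => h3; nra.
have := P0E p p_pr p4 P0p x xK.
rewrite (paley_normsqE p_pr p4) sumx xp mulr0 mul0r addr0.
have -> : \sum_(a : 'F_p) \sum_(b : 'F_p) (legendre (a - b))%:~R * (x (inord a) * x (inord b))
    = n%:R * (n%:R - 1) :> R.
  rewrite -[X in X%:R * _]cardT mulr_natl -sumr_const [RHS]big_mkcond; apply: eq_bigr => a _ /=.
  rewrite xa; case: ifPn => aT; last by rewrite big1 // => b _; rewrite mul0r mulr0.
  (* The diagonal contributes 0, so each row of the clique sums to [n - 1]. *)
  have -> : n%:R - 1 = \sum_(b : 'F_p | b != a) (if b \in T then 1 else 0) :> R.
    by rewrite -cardT -[X in X - 1]sumr_const big_mkcond (bigD1 a) //= aT addrAC subrr add0r.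
  rewrite (bigD1 a) //= subrr {1}/legendre eqxx mul0r add0r.
  apply: eq_bigr => b ba; rewrite xa mul1r.
  case: ifPn => bT; last by rewrite mulr0.
  have -> : legendre (a - b) = 1.
    by apply: cliqueS; [exact: (fintype.subsetP TS) | exact: (fintype.subsetP TS) | rewrite eq_sym].
  by rewrite mulr1.
set g := paley_gauss R p / p%:R; move=> [lo hi].
pose d : R := p%:R `^ (tau - 1 / 2 + e / 2); rewrite -!/d in lo hi.
have n1 : 1 <= n%:R :> R by rewrite ler1n.
have gs : `|g| = p%:R `^ (- (1 / 2)).
  rewrite -sqrt_invr_powR ?(prime_gt0 p_pr) // -[LHS]sqrtr_sqr expr_div_n paley_gauss_sqr //.
  by congr Num.sqrt; field; rewrite gt_eqF.
(* The test vector gives [n + g n (n - 1)]; dividing [lo] and [hi] by [n] bounds [g (n - 1)] on both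
   sides, whatever the sign of [g]. *)
have gn : `|g| * (n%:R - 1) <= d.
  rewrite -(ger0_norm (_ : 0 <= n%:R - 1)) ?subr_ge0 // -normrM ler_norml.
  by apply/andP; split; nra.
have : n%:R - 1 <= p%:R `^ (t + e / 2) :> R.
  have : p%:R `^ (1 / 2) * (`|g| * (n%:R - 1)) <= p%:R `^ (1 / 2) * d :> R.
    by rewrite ler_wpM2l ?powR_ge0.
  rewrite gs mulrA -powD subrr powRr0 mul1r /d -powD => /le_trans; apply.
  by rewrite ler_powR //; lra.
have h2 : 1 <= p%:R `^ (t + e / 2) :> R.
  by rewrite -[leLHS](powRr0 p%:R) ler_powR // addr_ge0 // divr_ge0 // ltW.
(* Contradiction: [n <= 1 + p^(t + e / 2) <= 2 p^(t + e / 2) < p^(t + e) < n]. *)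
have := P1E p P1p; rewrite mul0r addr0 => h3.
move: nE; rewrite (_ : t + e = (t + e / 2) + e / 2) ?powD -?powD; last by field.
rewrite powD; nra.
Qed.

Theorem mainTheorem1 (R : realType) :
  (stmtA R -> stmtB R) /\ (stmtB R -> stmtC R).
Proof. by split; [exact: discrepancy_RIP | exact: RIP_clique]. Qed.
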